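(* Let $\Sigma$ be a finite alphabet and let $L(\mathcal{A})\subseteq T_\Sigma^\omega$ be a regular tree language accepted by a Büchi tree automaton $\mathcal{A}$ such that $L(\mathcal{A})$ is an analytic but non-Borel set. Then the set of trees $t\in T_\Sigma^\omega$ which have $2^{\aleph_0}$ accepting runs by $\mathcal{A}$ has cardinality $2^{\aleph_0}$.
   Context: For a finite alphabet $\Sigma$, $T_\Sigma^\omega$ is the set of all functions $t:\{l,r\}^\star\to\Sigma$ (infinite binary trees labelled in $\Sigma$, with root the empty word $\lambda$), with the Cantor (product of discrete) topology. A path of $t$ is an infinite sequence $t(u_0)t(u_1)\cdots$ of labels along an infinite branch, where $u_0=\lambda$ and $u_{i+1}\in\{u_il,u_ir\}$ for all $i$. A (nondeterministic) Büchi tree automaton is a tuple $\mathcal{A}=(K,\Sigma,\Delta,q_0,F)$ with $K$ a finite set of states, $\Sigma$ a finite alphabet, $\Delta\subseteq K\times\Sigma\times K\times K$, $q_0\in K$ and $F\subseteq K$. A run of $\mathcal{A}$ on $t\in T_\Sigma^\omega$ is a tree $\rho\in T_K^\omega$ with $\rho(\lambda)=q_0$ and $(\rho(u),t(u),\rho(u\cdot l),\rho(u\cdot r))\in\Delta$ for all $u\in\{l,r\}^\star$. The run is accepting if on each path of $\rho$ some state of $F$ appears infinitely often. $L(\mathcal{A})$ is the set of trees $t\in T_\Sigma^\omega$ on which $\mathcal{A}$ has at least one accepting run. (A tree language accepted by a Büchi tree automaton is in particular regular, i.e. accepted by some Muller tree automaton, so ''regular'' imposes no additional condition.) $2^{\aleph_0}$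 is the cardinality of the continuum. ''A tree $t$ has $2^{\aleph_0}$ accepting runs'' means that the set of accepting runs of $\mathcal{A}$ on $t$ has cardinality $2^{\aleph_0}$. *)

(* Defs.v *)
From HB Require Import structures.
From mathcomp Require Import all_boot all_classical.
From mathcomp Require Import topology measurable_structure.

Set Implicit Arguments.
Unset Strict Implicit.
Unset Printing Implicit Defensive.

Local Open Scope classical_set_scope.

(* The two directions l and r; a node is a word over them, the root is [::]
   and the successors of u are rcons u l and rcons u r *)
Definition direction : Type := bool.
Definition l : direction := false.
Definition r : direction := true.
Definition node : Type := seq direction.

(* T_X^omega with the Cantor topology; as a plain type, tree X is node -> X *)
Definition tree (X : finType) : Type :=
  prod_topology (fun _ : node => discrete_topology X).
HB.instance Definition _ (X : finType) := Topological.on (tree X).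

Record buchi_automaton (Sigma : finType) := BuchiAutomaton {
  state : finType;
  delta : {set state * Sigma * state * state};
  init : state;
  final : {set state}
}.

Definition branch (u : nat -> node) : Prop :=
  u 0 = [::] /\
  forall i, u i.+1 = rcons (u i) l \/ u i.+1 = rcons (u i) r.

Section Buchi.
Variables (Sigma : finType) (A : buchi_automaton Sigma).

Definition is_run (t : tree Sigma) (rho : tree (state A)) : Prop :=
  rho [::] = init A /\
  forall u : node,
    (rho u, t u, rho (rcons u l), rho (rcons u r)) \in delta A.

Definition accepting (rho : tree (state A)) : Prop :=
  forall u, branch u ->
    exists2 q, q \in final A & infinite_set [set n | rho (u n) = q].

Definition accepting_runs (t : tree Sigma) : set (tree (state A)) :=
  [set rho | is_run t rho /\ accepting rho].

Definition language : set (tree Sigma) :=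
  [set t | exists rho, accepting_runs t rho].

End Buchi.

Arguments is_run {Sigma} A t rho.
Arguments accepting {Sigma} A rho.
Arguments accepting_runs {Sigma} A t.
Arguments language {Sigma} A.

Definition borel (T : topologicalType) (B : set T) : Prop := <<s open >> B.

Definition baire_space : topologicalType := prod_topology (fun _ : nat => nat).

(* Meant for Polish T, such as tree X: being the continuous image of some
   Polish space is the same as being empty or a continuous image of Baire space *)
Definition analytic (T : topologicalType) (B : set T) : Prop :=
  B = set0 \/ exists2 f : baire_space -> T, continuous f & B = range f.

Definition has_card_continuum (T : Type) (B : set T) : Prop :=
  (B #= [set: nat -> bool])%card.

(* Main.v *)
Require Import Defs.
From mathcomp Require Import all_boot all_classical.
From mathcomp Require Import topology measurable_structure.

(* The relation E between trees and their accepting runs is a G_delta set: by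
   Koenig's lemma a run is accepting iff below every node u there is a depth k
   within which every path meets a final state.  Its projection is the language.

   Let E be any G_delta subset of X * Y with non-Borel projection proj E.  Call a
   finite family (P_i) of subsets of E small if there are Borel sets
   B_i >= proj P_i whose intersection lies in proj E; the family (E) is not small.
   As smallness is sigma-additive in each coordinate, a non-small family can be
   cut down to two disjoint cylinders of X while remaining non-small, and each P_i
   can be replaced by two pieces of small diameter with disjoint Y-projections.
   Iterating gives a Cantor scheme whose limits are points x_a and, for each a,
   points y_(a,b) in the fibre of x_a, for a and b ranging over 2^omega. *)

Set Implicit Arguments.
Unset Strict Implicit.
Unset Printing Implicit Defensive.

Local Open Scope classical_set_scope.

(** * Closure of a sigma-algebra under countable quantifiers and connectives *)

Section SigmaAlgebra.
Variables (T : Type) (M : set (set T)).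
Hypothesis sM : sigma_algebra setT M.

Lemma sigma_algebra_setC (A : set T) : M A -> M (~` A).
Proof. by move=> MA; rewrite -setTD; case: sM => _ + _; exact. Qed.

Lemma sigma_algebra_cst (Q : Prop) : M [set _ | Q].
Proof.
have M0 : M set0 by case: sM.
have [q|nq] := pselect Q.
  have -> : [set _ : T | Q] = ~` set0 by apply/seteqP; split => // t _ [].
  exact: sigma_algebra_setC.
by have -> : [set _ : T | Q] = set0 by apply/seteqP; split.
Qed.

Lemma sigma_algebra_exists (J : countType) (F : J -> set T) :
  (forall j, M (F j)) -> M [set x | exists j, F j x].
Proof.
move=> MF; pose G k := if unpickle k is Some j then F j else set0.
have -> : [set x | exists j, F j x] = \bigcup_k G k.
  apply/seteqP; split=> [x [j Fjx]|x [k _]].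
    by exists (pickle j) => //; rewrite /G pickleK.
  by rewrite /G; case: unpickle => // j Fjx; exists j.
case: sM => M0 _; apply => k; rewrite /G.
by case: unpickle.
Qed.

Lemma sigma_algebra_forall (J : countType) (F : J -> set T) :
  (forall j, M (F j)) -> M [set x | forall j, F j x].
Proof.
move=> MF; have -> : [set x | forall j, F j x] =
    ~` [set x | exists j, (~` F j) x].
  apply/seteqP; split=> [x Fx [j]|x nF j]; first exact.
  by apply: contrapT => nFj; apply: nF; exists j.
apply: sigma_algebra_setC; apply: sigma_algebra_exists => j.
exact: sigma_algebra_setC.
Qed.

Lemma sigma_algebra_or (A B : set T) : M A -> M B -> M [set x | A x \/ B x].
Proof.
move=> MA MB.
have -> : [set x | A x \/ B x] = [set x | exists b : bool, (if b then A else B) x].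
  apply/seteqP; split=> [x [Ax|Bx]|x [[] ?]]; by [exists true|exists false|left|right].
by apply: sigma_algebra_exists => -[].
Qed.

Lemma sigma_algebra_impl (A B : set T) : M A -> M B -> M [set x | A x -> B x].
Proof.
move=> MA MB; have -> : [set x | A x -> B x] = [set x | (~` A) x \/ B x].
  apply/seteqP; split=> [x AB|x [nA|Bx]] //=.
  by have [Ax|nAx] := pselect (A x); [right; exact: AB|left].
by apply: sigma_algebra_or => //; exact: sigma_algebra_setC.
Qed.

Lemma sigma_algebra_and (A B : set T) : M A -> M B -> M [set x | A x /\ B x].
Proof.
move=> MA MB.
have -> : [set x | A x /\ B x] = [set x | forall b : bool, (if b then A else B) x].
  apply/seteqP; split=> [x [Ax Bx] []//|x AB /=].
  by split; [exact: (AB true)|exact: (AB false)].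
by apply: sigma_algebra_forall => -[].
Qed.

End SigmaAlgebra.

(** * Finite prefixes and limits in a product of countable discrete spaces *)

Section Stem.
Variables (T S : countType).
Implicit Types x y : T -> S.

(* The first n coordinates of x; indices that code no element of T give [None]. *)
Definition stem n x : seq (option S) :=
  [seq omap x (pickle_inv i) | i <- iota 0 n].

Lemma size_stem n x : size (stem n x) = n.
Proof. by rewrite size_map size_iota. Qed.

Lemma take_stem m n x : m <= n -> take m (stem n x) = stem m x.
Proof. by move=> mn; rewrite /stem -map_take take_iota (minn_idPl mn). Qed.

Lemma stemW m n x y : m <= n -> stem n x = stem n y -> stem m x = stem m y.
Proof. by move=> mn xy; rewrite -(take_stem x mn) xy take_stem. Qed.

Lemma stemP n x y :
  stem n x = stem n y <-> forall u, pickle u < n -> x u = y u.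
Proof.
split=> [xy u un|xy].
  have := congr1 (fun s => nth None s (pickle u)) xy.
  by rewrite !(nth_map 0) ?size_iota// nth_iota// add0n pickleK_inv => -[].
apply/eq_in_map => i; rewrite mem_iota add0n => /andP[_ ilt].
have := @pickle_invK T i; case: pickle_inv => //= u ui.
by rewrite xy// ui.
Qed.

Lemma stem_inj x y : (forall n, stem n x = stem n y) -> x = y.
Proof.
move=> xy; apply/funext => u.
by have /stemP := xy (pickle u).+1; apply.
Qed.

(** Coordinate [u] is settled from stage [(pickle u).+1] on, the first whose stem records it; the
    limit reads it off there. *)
Lemma stem_lim (z : nat -> T -> S) :
  (forall n, stem n (z n) = stem n (z n.+1)) ->
  exists x, forall n, stem n x = stem n (z n).
Proof.
move=> zS; have zD m n : m <= n -> stem m (z n) = stem m (z m).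
  elim: n => [|n IHn]; first by rewrite leqn0 => /eqP->.
  rewrite leq_eqVlt => /orP[/eqP->//|]; rewrite ltnS => mn.
  by rewrite -IHn//; apply/esym/(stemW mn)/zS.
exists (fun u => z (pickle u).+1 u) => n; apply/stemP => u un.
by have /stemP := zD _ _ un; move=> /(_ u)->.
Qed.

Lemma sigma_algebra_stem (M : set (set (T -> S))) n a :
  sigma_algebra setT M -> (forall u s, M [set x | x u = s]) ->
  M [set x | stem n x = a].
Proof.
move=> sM Mcyl.
have [[x0 <-]|none] := pselect (exists x0, stem n x0 = a); last first.
  have -> : [set x | stem n x = a] = [set _ | False].
    by apply/seteqP; split=> [x /= xa|//]; apply: none; exists x.
  exact: sigma_algebra_cst.
have -> : [set x | stem n x = stem n x0] =
    [set x | forall u, pickle u < n -> x u = x0 u].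
  by apply/seteqP; split=> x /stemP.
apply: (sigma_algebra_forall sM (F := fun u => [set x | pickle u < n -> x u = x0 u])) => u.
apply: (sigma_algebra_impl sM (A := [set _ | pickle u < n])).
  exact: sigma_algebra_cst.
exact: Mcyl.
Qed.

End Stem.

(** * Small families and the splitting of non-small ones *)

Section Splitting.
Variables (T1 T2 S1 S2 : countType).
Local Notation X := (T1 -> S1).
Local Notation Y := (T2 -> S2).
Variables (M : set (set X)) (U : nat -> X -> Y -> Prop).
Hypothesis sM : sigma_algebra setT M.
Hypothesis Mcyl : forall u s, M [set x | x u = s].
Hypothesis openU : forall n x y, U n x y -> exists m, forall x' y',
  stem m x' = stem m x -> stem m y' = stem m y -> U n x' y'.

Local Notation E := (fun x y => forall n, U n x y).
Local Notation proj := [set x | exists y, forall n, U n x y].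

(** For a one-point [I] this asks for a set of [M] between the projection of [P] and [proj]. *)
Definition small (I : Type) (P : I -> X -> Y -> Prop) :=
  exists B : I -> set X, [/\ forall i, M (B i),
    forall i x y, P i x y -> B i x &
    forall x, (forall i, B i x) -> proj x].

(** An empty [P i] admits the empty set as [B i], with the whole space at the other indices. *)
Lemma nonsmall_inhabited (I : Type) (P : I -> X -> Y -> Prop) i :
  ~ small P -> exists x y, P i x y.
Proof.
apply: contra_notP => Pi0.
exists (fun j => [set _ | j <> i]); split.
- by move=> j; exact: sigma_algebra_cst.
- by move=> j x y Pxy ji; apply: Pi0; exists x, y; rewrite -ji.
- by move=> x /(_ i).
Qed.

(** Two disjoint cylinders, taken as [B i] and [B j], would have empty intersection. The
    implications in the witness also cover [i = j]. *)
Lemma nonsmall_stem_eq (I : Type) (P : I -> X -> Y -> Prop) i j m a b :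
  ~ small P -> (forall x y, P i x y -> stem m x = a) ->
  (forall x y, P j x y -> stem m x = b) -> a = b.
Proof.
move=> + Pa Pb; apply: contra_notP => ab.
exists (fun k => [set x | (k = i -> stem m x = a) /\ (k = j -> stem m x = b)]).
split.
- move=> k; apply: (sigma_algebra_and sM (A := [set x | k = i -> stem m x = a])
     (B := [set x | k = j -> stem m x = b])).
    apply: (sigma_algebra_impl sM (A := [set _ | k = i])).
      exact: sigma_algebra_cst.
    exact: sigma_algebra_stem.
  apply: (sigma_algebra_impl sM (A := [set _ | k = j])).
    exact: sigma_algebra_cst.
  exact: sigma_algebra_stem.
- by move=> k x y Pxy; split=> kE; [apply: (Pa x y)|apply: (Pb x y)]; rewrite -kE.
- move=> x Bx; case: ab.
  by rewrite -((Bx i).1 erefl) -((Bx j).2 erefl).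
Qed.

(** A point is the countable intersection of its cylinders. *)
Lemma sigma_algebra_subsingleton (Z : set X) :
  (forall x x', Z x -> Z x' -> x = x') -> M Z.
Proof.
move=> Z1; have [[z Zz]|none] := pselect (exists z, Z z); last first.
  have -> : Z = [set _ | False].
    by apply/seteqP; split=> [x /= Zx|//]; apply: none; exists x.
  exact: sigma_algebra_cst.
have -> : Z = [set x | forall n, stem n x = stem n z].
  apply/seteqP; split=> [x Zx n|x /stem_inj->//].
  by rewrite (Z1 _ _ Zx Zz).
apply: (sigma_algebra_forall sM (F := fun n => [set x | stem n x = stem n z])) => n.
exact: sigma_algebra_stem.
Qed.

(* Points all of whose cylinders meet the family in a non-small family form a set
   with at most one element unless the conclusion holds; such a set is Borel and so
   is any part of it, whence the family is small over it. *)
Lemma split_fst (I : Type) (i0 : I) (P : I -> X -> Y -> Prop) :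
  (forall i x y, P i x y -> E x y) -> ~ small P ->
  exists m a a', [/\ a <> a',
    ~ small (fun i x y => P i x y /\ stem m x = a) &
    ~ small (fun i x y => P i x y /\ stem m x = a')].
Proof.
move=> PE; apply: contra_notP => uniq_stem.
pose R (c : nat * seq (option S1)) i x y := P i x y /\ stem c.1 x = c.2.
have Rinj m a a' : ~ small (R (m, a)) -> ~ small (R (m, a')) -> a = a'.
  move=> sa sa'; apply: contrapT => aa'.
  by apply: uniq_stem; exists m, a, a'.
have /choice[B BP] : forall c, exists B : I -> set X, small (R c) ->
    [/\ forall i, M (B i), forall i x y, R c i x y -> B i x &
        forall x, (forall i, B i x) -> proj x].
  move=> c; have [[B BP]|ns] := pselect (small (R c)); first by exists B.
  by exists (fun=> setT).
pose Z : set X := [set x | forall m, ~ small (R (m, stem m x))].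
have Z1 x x' : Z x -> Z x' -> x = x'.
  by move=> Zx Zx'; apply: stem_inj => n; exact: Rinj.
(* Each small cylinder around [x] contributes its set [B c i], and the points of [Z] outside [proj]
   are cut out. A point that remains lies in [proj] or in some small cylinder. *)
exists (fun i => [set x | ~ (Z x /\ ~ proj x) /\
  forall c, (stem c.1 x = c.2 /\ small (R c)) -> B c i x]); split.
- move=> i; apply: (sigma_algebra_and sM (A := ~` [set x | Z x /\ ~ proj x])
    (B := [set x | forall c, (stem c.1 x = c.2 /\ small (R c)) -> B c i x])).
    apply/(sigma_algebra_setC sM)/sigma_algebra_subsingleton => x x' [+ _] [+ _].
    exact: Z1.
  apply: (sigma_algebra_forall sM
    (F := fun c => [set x | (stem c.1 x = c.2 /\ small (R c)) -> B c i x])) => c.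
  have [sc|nsc] := pselect (small (R c)); last first.
    have -> : [set x | (stem c.1 x = c.2 /\ small (R c)) -> B c i x] = [set _ | True].
      by apply/seteqP; split=> [//|x _ [_ /nsc]].
    exact: sigma_algebra_cst.
  apply: (sigma_algebra_impl sM (A := [set x | stem c.1 x = c.2 /\ small (R c)])).
    apply: (sigma_algebra_and sM (A := [set x | stem c.1 x = c.2])
      (B := [set _ | small (R c)])).
      exact: sigma_algebra_stem.
    exact: sigma_algebra_cst.
  by have [] := BP c sc.
- move=> i x y Pxy; split=> [[_]|c [xc sc]].
    by apply; exists y; exact: PE Pxy.
  by have [_ + _] := BP c sc; move=> /(_ i x y); apply; split.
- move=> x Bx; have [Zx|/existsNP[m /contrapT sm]] := pselect (Z x).
    by apply: contrapT => nx; have [] := Bx i0; case.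
  have [_ _] := BP _ sm; apply => i.
  by apply: (Bx i).2.
Qed.

Local Notation piece := (seq (option S1) * seq (option S2))%type.

Definition in_piece (q : piece) (x : X) (y : Y) :=
  stem (size q.1) x = q.1 /\ stem (size q.2) y = q.2.

(** Bounding all [k <= n] at once puts a limit of ever finer boxes into every [U k], hence into
    [E]. *)
Definition fine n (q : piece) :=
  [/\ n <= size q.1, n <= size q.2 &
      forall k, k <= n -> forall x y, in_piece q x y -> U k x y].

Definition apart (b b' : seq (option S2)) :=
  forall y : Y, stem (size b) y = b -> stem (size b') y = b' -> False.

Lemma fineW m n q : m <= n -> fine n q -> fine m q.
Proof.
move=> mn [q1 q2 qU]; split; [exact: leq_trans q1|exact: leq_trans q2|].
by move=> k km; apply: qU; exact: leq_trans mn.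
Qed.

Lemma ex_fine n x y : E x y -> exists2 q, fine n q & in_piece q x y.
Proof.
move=> Exy; suff [m nm mU] : exists2 m, n <= m & forall k, k <= n ->
    forall x' y', stem m x' = stem m x -> stem m y' = stem m y -> U k x' y'.
  exists (stem m x, stem m y); last by rewrite /in_piece !size_stem.
  split; rewrite ?size_stem// => k kn x' y' []/=; rewrite !size_stem.
  exact: mU.
elim: n => [|n [m nm mU]].
  have [m mU] := openU (Exy 0); exists m => // k; rewrite leqn0 => /eqP->.
  exact: mU.
have [m' mU'] := openU (Exy n.+1).
exists (maxn n.+1 (maxn m m')); first exact: leq_maxl.
have mM : m <= maxn n.+1 (maxn m m') by rewrite !leq_max leqnn orbT.
have mM' : m' <= maxn n.+1 (maxn m m') by rewrite !leq_max leqnn !orbT.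
move=> k; rewrite leq_eqVlt => /orP[/eqP->|kn] x' y' xx' yy'.
  by apply: mU'; [exact: stemW xx'|exact: stemW yy'].
by apply: (mU k kn); [exact: stemW xx'|exact: stemW yy'].
Qed.

(* Overlapping pieces of increasing fineness shrink to a point of the fibre. *)
Lemma fine_lim x n (q : nat -> piece) :
  (forall m, fine (n + m) (q m) /\ stem (size (q m).1) x = (q m).1) ->
  (forall m m', ~ apart (q m).2 (q m').2) -> proj x.
Proof.
move=> qP qq.
have /choice[z zP] : forall m, exists y : Y, stem (size (q m).2) y = (q m).2.
  move=> m; apply: contrapT => none; apply: (qq m m) => y ym _.
  by apply: none; exists y.
have qsize m : m <= size (q m).2.
  by have [[_ + _] _] := qP m; apply: leq_trans; exact: leq_addl.
have zz m m' k : k <= size (q m).2 -> k <= size (q m').2 ->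
    stem k (z m) = stem k (z m').
  move=> km km'; have /existsNP[y] := qq m m'.
  move=> /not_implyP[ym /not_implyP[ym' _]].
  rewrite -(take_stem (z m) km) zP -ym take_stem//.
  by rewrite -(take_stem (z m') km') zP -ym' take_stem.
have [y yP] : exists y : Y, forall m, stem m y = stem m (z m).
  apply: stem_lim => m; apply: zz => //.
  exact: leq_trans (leqnSn _) (qsize m.+1).
exists y => k; have [[_ _ /(_ k) +] xk] := qP k.
apply; first exact: leq_addl.
split => //; rewrite yP -[RHS]zP; apply: zz => //.
Qed.

(* If all such families of pieces were small, the Borel sets C i q witnessing it
   would show that P is small: a point x lying, for every i, in sets C i q of all
   finenesses either has two such q apart for each i, or has a fibre by fine_lim. *)
Lemma split_snd (I : finType) n (P : I -> X -> Y -> Prop) :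
  (forall i x y, P i x y -> E x y) -> ~ small P ->
  exists q : I * bool -> piece,
    [/\ ~ small (fun j x y => P j.1 x y /\ in_piece (q j) x y),
        forall j, fine n (q j) &
        forall i, apart (q (i, false)).2 (q (i, true)).2].
Proof.
move=> PE; apply: contra_notP => all_small.
(* Choices of pieces are finite functions because these form a countable type, so that intersections
   over all of them stay in [M]. This is where [I] has to be finite. *)
pose good (Q : {ffun I * bool -> piece}) :=
  (forall j, fine n (Q j)) /\ forall i, apart (Q (i, false)).2 (Q (i, true)).2.
have /choice[B BP] : forall Q : {ffun I * bool -> piece},
    exists B : I * bool -> set X, good Q ->
    [/\ forall j, M (B j),
        forall j x y, P j.1 x y /\ in_piece (Q j) x y -> B j x &
        forall x, (forall j, B j x) -> proj x].
  move=> Q; have [[gQ gQ']|ngQ] := pselect (good Q); last by exists (fun=> setT).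
  suff [B BP] : small (fun j x y => P j.1 x y /\ in_piece (Q j) x y) by exists B.
  by apply: contrapT => ns; apply: all_small; exists Q.
(* The piece [q] may occur at [i] in many good [Q]; [C i q] meets the demands of all of them, in
   either position [c]. *)
pose C i (q : piece) x := stem (size q.1) x = q.1 /\
  forall (Q : {ffun I * bool -> piece}) c, good Q /\ Q (i, c) = q -> B Q (i, c) x.
have MC i q : M [set x | C i q x].
  apply: (sigma_algebra_and sM (A := [set x | stem (size q.1) x = q.1])).
    exact: sigma_algebra_stem.
  apply: (sigma_algebra_forall sM (F := fun Q : {ffun I * bool -> piece} =>
    [set x | forall c, good Q /\ Q (i, c) = q -> B Q (i, c) x])) => Q.
  apply: (sigma_algebra_forall sM (F := fun c =>
    [set x | good Q /\ Q (i, c) = q -> B Q (i, c) x])) => c.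
  have [gQ|ngQ] := pselect (good Q /\ Q (i, c) = q).
    apply: (sigma_algebra_impl sM (A := [set _ | good Q /\ Q (i, c) = q])).
      exact: sigma_algebra_cst.
    by have [+ _ _] := BP Q gQ.1; exact.
  have -> : [set x | good Q /\ Q (i, c) = q -> B Q (i, c) x] = [set _ | True].
    by apply/seteqP; split=> [//|x _ /ngQ].
  exact: sigma_algebra_cst.
exists (fun i => [set x | forall m, exists q, fine (n + m) q /\ C i q x]); split.
- move=> i; apply: (sigma_algebra_forall sM
    (F := fun m => [set x | exists q, fine (n + m) q /\ C i q x])) => m.
  apply: (sigma_algebra_exists sM
    (F := fun q => [set x | fine (n + m) q /\ C i q x])) => q.
  apply: (sigma_algebra_and sM (A := [set _ | fine (n + m) q])
    (B := [set x | C i q x])) => //.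
  exact: sigma_algebra_cst.
- move=> i x y Pxy m; have [q fq qxy] := ex_fine (n + m) (PE _ _ _ Pxy).
  exists q; split=> //; split; first exact: qxy.1.
  move=> Q c [gQ Qq]; have [_ + _] := BP Q gQ; apply; split; first exact: Pxy.
  by rewrite Qq; exact: qxy.
- move=> x Bx; have /choice[q qP] : forall im : I * nat,
      exists q, fine (n + im.2) q /\ C im.1 q x.
    by move=> [i m]; exact: Bx.
  have [[i qi]|noi] := pselect (exists i, forall m m',
      ~ apart (q (i, m)).2 (q (i, m')).2).
    apply: (fine_lim (n := n) (q := fun m => q (i, m))) => // m.
    by have [? [? _]] := qP (i, m).
  have /choice[f fP] : forall i, exists mm : nat * nat,
      apart (q (i, mm.1)).2 (q (i, mm.2)).2.
    move=> i; apply: contrapT => none; apply: noi; exists i => m m' a.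
    by apply: none; exists (m, m').
  pose Q := [ffun j : I * bool => q (j.1, if j.2 then (f j.1).2 else (f j.1).1)].
  have gQ : good Q.
    split=> [j|i]; rewrite !ffunE//=.
    by apply: fineW (qP _).1; exact: leq_addr.
  have [_ _] := BP Q gQ; apply => -[i c].
  have [_ [_ CQ]] := qP (i, if c then (f i).2 else (f i).1).
  by apply: CQ; split=> //; rewrite ffunE.
Qed.

Lemma split_both (I : finType) (i0 : I) n (P : I -> X -> Y -> Prop) :
  (forall i x y, P i x y -> E x y) -> ~ small P ->
  exists P' : bool -> I * bool -> X -> Y -> Prop,
    [/\ forall e, ~ small (P' e),
        forall e j x y, P' e j x y -> P j.1 x y,
        forall e j, exists2 q, fine n q & forall x y, P' e j x y -> in_piece q x y,
        forall e i, exists b b', [/\ apart b b',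
          forall x y, P' e (i, false) x y -> stem (size b) y = b &
          forall x y, P' e (i, true) x y -> stem (size b') y = b'] &
        exists m a a', [/\ a <> a',
          forall j x y, P' false j x y -> stem m x = a &
          forall j x y, P' true j x y -> stem m x = a']].
Proof.
move=> PE nsP; have [m [a [a' [aa' nsa nsa']]]] := split_fst i0 PE nsP.
pose R (e : bool) i x y := P i x y /\ stem m x = if e then a' else a.
have nsR e : ~ small (R e) by case: e.
have RE e i x y : R e i x y -> E x y by case=> /PE.
have /choice[q qP] := fun e => split_snd n (@RE e) (@nsR e).
exists (fun e j x y => R e j.1 x y /\ in_piece (q e j) x y); split.
- by move=> e; have [] := qP e.
- by move=> e j x y [[]].
- by move=> e j; exists (q e j); [have [] := qP e|move=> x y []].
- move=> e i; exists (q e (i, false)).2, (q e (i, true)).2; split.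
  + by have [] := qP e.
  + by move=> x y [_ []].
  + by move=> x y [_ []].
- exists m, a, a'; split=> //.
  + by move=> j x y [[]].
  + by move=> j x y [[]].
Qed.

(** * The Cantor scheme and its limit points *)

Fixpoint word n : finType := if n is k.+1 then (word k * bool)%type else unit.

(** The newest bit is the outer component, so that splitting a family over [word n] yields one over
    [word n.+1] by conversion. *)
Fixpoint restr (b : nat -> bool) n : word n :=
  if n is k.+1 then (restr b k, b k) else tt.

Lemma eq_restr b b' n : (forall k, k < n -> b k = b' k) -> restr b n = restr b' n.
Proof.
elim: n => //= n IHn bb'; rewrite bb'// IHn// => k kn.
by apply: bb'; exact: ltnW.
Qed.

(** At each stage [a] chooses a half on the X side and [b] a member of the resulting family. Keeping
    all members in one non-small family forces their limits to share the point [f a]. *)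
Theorem nonborel_proj_many_large_fibres : ~ M proj ->
  exists (f : (nat -> bool) -> X) (g : (nat -> bool) -> (nat -> bool) -> Y),
    [/\ injective f, forall a, injective (g a) & forall a b, E (f a) (g a b)].
Proof.
move=> nMproj.
pose state n := {P : word n -> X -> Y -> Prop |
  (forall i x y, P i x y -> E x y) /\ ~ small P}.
have step_ex n (s : state n) : exists s' : bool -> state n.+1,
    [/\ forall e j x y, sval (s' e) j x y -> sval s j.1 x y,
        forall e j, exists2 q, fine n q & forall x y, sval (s' e) j x y -> in_piece q x y,
        forall e i, exists b b', [/\ apart b b',
          forall x y, sval (s' e) (i, false) x y -> stem (size b) y = b &
          forall x y, sval (s' e) (i, true) x y -> stem (size b') y = b'] &
        exists m a a', [/\ a <> a',
          forall j x y, sval (s' false) j x y -> stem m x = a &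
          forall j x y, sval (s' true) j x y -> stem m x = a']].
  have [PE nsP] := svalP s.
  have [P' [ns' sub' fine' apart' fst']] :=
    split_both (restr (fun=> true) n) n PE nsP.
  have PE' e j x y : P' e j x y -> E x y by move=> /sub'/PE.
  by exists (fun e => exist _ (P' e) (conj (@PE' e) (ns' e))).
pose step n s := sval (cid (step_ex n s)).
have stepP n s := svalP (cid (step_ex n s)).
have ns0 : ~ small (fun (_ : word 0) => E).
  move=> [B [MB EB Bproj]]; apply: nMproj.
  have <- : B tt = proj; last exact: MB.
  apply/seteqP; split=> [x Bx|x [y Exy]]; last exact: EB Exy.
  by apply: Bproj => -[].
pose s0 : state 0 := exist _ (fun=> E) (conj (fun _ _ _ Exy => Exy) ns0).
pose S a := nat_rect state s0 (fun n s => step n s (a n)).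
pose D a b n := sval (S a n) (restr b n).
have DS a b n x y : D a b n.+1 x y -> D a b n x y.
  by have [+ _ _ _] := stepP n (S a n); apply.
have Dsub a b m n x y : m <= n -> D a b n x y -> D a b m x y.
  elim: n => [|n IHn]; first by rewrite leqn0 => /eqP->.
  by rewrite leq_eqVlt => /orP[/eqP->//|mn /DS]; exact: IHn.
have Dfine a b n : exists2 q, fine n q & forall x y, D a b n.+1 x y -> in_piece q x y.
  by have [_ + _ _] := stepP n (S a n); apply.
have Dstem a b n : exists u v,
    forall x y, D a b n.+1 x y -> stem n x = u /\ stem n y = v.
  have [q [q1 q2 _] Dq] := Dfine a b n.
  exists (take n q.1), (take n q.2) => x y /Dq[<- <-].
  by rewrite !take_stem.
have Dinh a b n : exists xy, D a b n xy.1 xy.2.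
  have [x [y Dxy]] := nonsmall_inhabited (restr b n) (svalP (S a n)).2.
  by exists (x, y).
(* The sets [D a b n] need not be closed, so their points only approximate the limit, to any
   precision. *)
have lim a b : exists xy : X * Y, forall n m, exists x' y',
    [/\ D a b n x' y', stem m x' = stem m xy.1 & stem m y' = stem m xy.2].
  (* Stems of length [n] are constant on stage [n.+1], hence the shift. *)
  have /choice[z zD] := fun n => Dinh a b n.+1.
  have zS n : stem n (z n).1 = stem n (z n.+1).1 /\ stem n (z n).2 = stem n (z n.+1).2.
    have [u [v Duv]] := Dstem a b n.
    have [-> ->] := Duv _ _ (zD n).
    by have [-> ->] := Duv _ _ (DS _ _ _ _ _ (zD n.+1)).
  have [x xP] := stem_lim (fun n => (zS n).1).
  have [y yP] := stem_lim (fun n => (zS n).2).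
  exists (x, y) => n m; pose N := maxn n m.
  exists (z N).1, (z N).2; split.
  - by apply: Dsub (zD N); rewrite leqW// leq_maxl.
  - by apply: stemW (esym (xP N)); exact: leq_maxr.
  - by apply: stemW (esym (yP N)); exact: leq_maxr.
have {lim}/choice[h hP] : forall ab, exists xy : X * Y, forall n m, exists x' y',
    [/\ D ab.1 ab.2 n x' y', stem m x' = stem m xy.1 & stem m y' = stem m xy.2].
  by move=> [a b]; exact: lim.
have h1 a b b' : (h (a, b)).1 = (h (a, b')).1.
  apply: stem_inj => m.
  have hstem c : forall x y, D a c m.+1 x y -> stem m x = stem m (h (a, c)).1.
    have [u [v Duv]] := Dstem a c m.
    have [x [y [/Duv[xu _] <- _]]] := hP (a, c) m.+1 m.
    by move=> x' y' /Duv[-> _].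
  exact: (nonsmall_stem_eq (svalP (S a m.+1)).2 (hstem b) (hstem b')).
exists (fun a => (h (a, fun=> true)).1), (fun a b => (h (a, b)).2); split.
- move=> a a' haa'; apply/funext => n.
  (* At the first disagreement [a] and [a'] leave the same family through its two halves, which have
     distinct stems. *)
  elim/ltn_ind: n => n IHn; apply: contrapT => aa'.
  pose b (_ : nat) := true.
  have Saa' : S a n = S a' n.
    elim: n IHn {aa'} => //= n IHn aa'; rewrite aa'// IHn// => k kn.
    by apply: aa'; exact: ltnW.
  have [_ _ _ [m [u [u' [uu' Du Du']]]]] := stepP n (S a n).
  have [x [y [Dxy xa _]]] := hP (a, b) n.+1 m.
  have [x' [y' [Dxy' xa' _]]] := hP (a', b) n.+1 m.
  have xx' : stem m x = stem m x' by rewrite xa xa' [X in stem m X]haa'.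
  move: Dxy Dxy' aa'; rewrite /D /= -Saa'.
  case: (a n); case: (a' n) => // Dxy Dxy' _; apply: uu'.
    by rewrite -(Du _ _ _ Dxy') -(Du' _ _ _ Dxy) xx'.
  by rewrite -(Du _ _ _ Dxy) -(Du' _ _ _ Dxy') xx'.
- move=> a b b' hbb'; apply/funext => n.
  (* At the first disagreement [b] and [b'] pick the two children of the same index, whose cylinders
     in Y are disjoint. *)
  elim/ltn_ind: n => n IHn; apply: contrapT => bb'.
  have [_ _ /(_ (a n) (restr b n))[v [v' [vv' Dv Dv']]] _] := stepP n (S a n).
  have [x [y [Dxy _ yb]]] := hP (a, b) n.+1 (maxn (size v) (size v')).
  have [x' [y' [Dxy' _ yb']]] := hP (a, b') n.+1 (maxn (size v) (size v')).
  have yy' : stem (maxn (size v) (size v')) y = stem (maxn (size v) (size v')) y'.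
    by rewrite yb yb' [X in stem _ X]hbb'.
  move: Dxy Dxy' bb'; rewrite /D /= -(eq_restr IHn).
  case: (b n); case: (b' n) => // Dxy Dxy' _.
    apply: (vv' y'); first exact: Dv Dxy'.
    by rewrite -(stemW (leq_maxr _ _) yy'); exact: Dv' Dxy.
  apply: (vv' y); first exact: Dv Dxy.
  by rewrite (stemW (leq_maxr _ _) yy'); exact: Dv' Dxy'.
- move=> a b n; rewrite (h1 a _ b).
  (* Lying in the box [q] depends on two prefixes only, so it passes from an approximant to the
     limit, and the box lies in [U n]. *)
  have [q [_ _ qU] Dq] := Dfine a b n.
  have [x [y [/Dq[x1 y1] xh yh]]] := hP (a, b) n.+1 (maxn (size q.1) (size q.2)).
  apply: (qU n) => //; split.
    by rewrite -(stemW (leq_maxl _ _) xh).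
  by rewrite -(stemW (leq_maxr _ _) yh).
Qed.

End Splitting.

(** * Sets of cardinality continuum *)

Section Continuum.
Local Open Scope card_scope.

Lemma has_card_continuum_inj (T S : countType) (B : set (T -> S))
    (f : (nat -> bool) -> T -> S) :
  injective f -> (forall a, B (f a)) -> has_card_continuum B.
Proof.
move=> finj fB; apply: Cantor_Bernstein.
  apply: (card_le_trans (subset_card_le (@subsetT _ B))).
  apply/pcard_injP.
  (* Each [x] is coded by the characteristic function of its graph, a subset of the countable
     [T * S]. *)
  exists (fun (x : T -> S) n => if unpickle n is Some (u, s) then x u == s else false).
  move=> x y _ _ xy; apply/funext => u.
  have := congr1 (@^~ (pickle (u, x u))) xy.
  by rewrite /= pickleK eqxx => /esym/eqP.
apply/card_subP; exists (range f); last by move=> _ [a _ <-].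
by apply: inj_card_eq => a b _ _; exact: finj.
Qed.

End Continuum.

(** * Koenig's lemma for binary words *)

Lemma koenig (bad : seq bool -> Prop) :
  (forall w w', bad (w ++ w') -> bad w) ->
  (forall k, exists2 w, size w = k & bad w) ->
  exists d : nat -> bool, forall n, bad (mkseq d n).
Proof.
move=> badW ex_bad.
(* If both children of a tall word failed to be tall, at lengths [k0] and [k1], a bad extension of
   length [(maxn k0 k1).+1] would pass through one of them and truncate to a forbidden one. *)
pose tall w := forall k, exists2 w', size w' = k & bad (w ++ w').
have tall_rcons w : exists c, tall w -> tall (rcons w c).
  have [tw|] := pselect (tall w); last by exists true.
  apply: contrapT => none.
  have short c : exists k, forall w', size w' = k -> ~ bad (rcons w c ++ w').
    apply: contrapT => tc; apply: none; exists c => _ k.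
    apply: contrapT => nk; apply: tc; exists k => w' w'k bw.
    by apply: nk; exists w'.
  have [k0 k0P] := short false; have [k1 k1P] := short true.
  have [[//|c w'] [w'k] bw] := tw (maxn k0 k1).+1.
  have {}short k : k <= maxn k0 k1 -> exists2 v, size v = k & bad (rcons w c ++ v).
    move=> kk; exists (take k w'); first by rewrite size_takel// w'k.
    by apply: (badW _ (drop k w')); rewrite -catA cat_take_drop cat_rcons.
  case: c bw short => bw short.
    by have [v /k1P] := short _ (leq_maxr k0 k1).
  by have [v /k0P] := short _ (leq_maxl k0 k1).
have [f fP] := choice tall_rcons.
pose p n := iter n (fun w => rcons w (f w)) [::].
have pE n : mkseq (fun i => f (p i)) n = p n.
  by elim: n => // n IHn; rewrite mkseqS IHn.
have tallp n : tall (p n).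
  by elim: n => [|n IHn]; [move=> k; exact: ex_bad|exact: fP].
exists (fun i => f (p i)) => n; rewrite pE.
by have [w _ /badW] := tallp n 0.
Qed.

(** * Acceptance as a countable intersection of open conditions *)

Section Acceptance.
Variables (Sigma : finType) (A : buchi_automaton Sigma).
Implicit Types (t : tree Sigma) (rho : tree (state A)).

(** The clause [0 < j] leaves out [u] itself, so that successive hits move strictly down a
    branch. *)
Definition hits rho (u : node) k :=
  forall w : node, size w = k ->
    exists j, [/\ 0 < j, j <= k & rho (u ++ take j w) \in final A].

Lemma branch_dir (b : nat -> node) : branch b ->
  exists d : nat -> bool, forall n j, b (n + j) = b n ++ mkseq (fun i => d (n + i)) j.
Proof.
move=> [_ bS].
have /choice[d dP] : forall n, exists c, b n.+1 = rcons (b n) c.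
  by move=> n; have [] := bS n; [exists l|exists r].
exists d => n; elim=> [|j IHj]; first by rewrite addn0 cats0.
by rewrite addnS dP IHj mkseqS rcons_cat.
Qed.

Lemma branch_mkseq (d : nat -> bool) : branch (mkseq d).
Proof. by split=> // i; rewrite mkseqS; case: (d i); [right|left]. Qed.

(** Without a bound below [u], Koenig's lemma gives a path from [u] with no later final state.
    Conversely, repeated hits give infinitely many final visits, and as [final A] is finite some
    state recurs. *)
Lemma acceptingP rho : accepting A rho <-> forall u, exists k, hits rho u k.
Proof.
split=> [acc u|hit b bb].
  apply: contrapT => nohit.
  pose bad w := forall j, 0 < j -> j <= size w -> rho (u ++ take j w) \notin final A.
  have [||d dP] := @koenig bad.
  - move=> w w' bw j j0 jw; rewrite -(takel_cat w' jw); apply: bw => //.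
    by rewrite size_cat (leq_trans jw)// leq_addr.
  - move=> k; apply: contrapT => none; apply: nohit; exists k => w wk.
    apply: contrapT => nw; apply: none; exists w => // j j0 jw.
    by apply/negP => Fj; apply: nw; exists j; rewrite -wk.
  (* The branch through [u] continued along [d]: its final states occur only at levels up to
     [size u]. The default [l] is never read. *)
  pose e i := if i < size u then nth l u i else d (i - size u).
  have eE j : mkseq e (size u + j) = u ++ mkseq d j.
    elim: j => [|j IHj].
      rewrite addn0 cats0 -[RHS](mkseq_nth l); apply/eq_in_map => i.
      by rewrite mem_iota /e => /andP[_ ->].
    by rewrite addnS mkseqS IHj mkseqS rcons_cat /e ltnNge leq_addr/= addKn.
  have [q qF] := acc _ (branch_mkseq e); apply.
  apply: (sub_finite_set _ (finite_II (size u).+1)) => n /= nq.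
  rewrite ltnS leqNgt; apply/negP => un.
  move: nq; rewrite -(subnKC (ltnW un)) eE => nq.
  have := dP (n - size u) (n - size u).
  rewrite subn_gt0 size_mkseq take_oversize ?size_mkseq//.
  by move=> /(_ un (leqnn _)); rewrite nq qF.
have [d dP] := branch_dir bb.
have visit n : exists2 m, n < m & rho (b m) \in final A.
  have [k kP] := hit (b n).
  have [j [j0 jk Fj]] := kP (mkseq (fun i => d (n + i)) k) (size_mkseq _ _).
  exists (n + j); first by rewrite -[ltnLHS]addn0 ltn_add2l.
  by move: Fj; rewrite dP /mkseq -map_take take_iota (minn_idPl jk).
apply: contrapT => none.
have fin q : q \in final A -> finite_set [set n | rho (b n) = q].
  by move=> qF; apply: contrapT => inf; apply: none; exists q.
have finU : finite_set (\bigcup_(q in [set` final A]) [set n | rho (b n) = q]).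
  by apply: bigcup_finite => //; exact: finite_finset.
have /choice[g gP] : forall n, exists m, n < m /\ rho (b m) \in final A.
  by move=> n; have [m nm Fm] := visit n; exists m.
have [h hmono hF] : exists2 h : nat -> nat, {homo h : m n / m < n} &
    forall n, rho (b (h n)) \in final A.
  (* The extra iteration skips level 0, whose state need not be final. *)
  exists (fun n => iter n.+1 g 0); last by move=> n; have [] := gP (iter n g 0).
  apply: homo_ltn => [|n]; first exact: ltn_trans.
  by have [] := gP (iter n.+1 g 0).
have : finite_set (range h).
  apply: sub_finite_set finU => _ [n _ <-].
  by exists (rho (b (h n))); first exact: hF.
apply/infiniteP/card_subP; exists (range h) => //.
apply: inj_card_eq => m n _ _ mn.
by case: (ltngtP m n) => // /hmono; rewrite mn ltnn.
Qed.

(** One open condition per node, enumerated through the coding of nodes; numbers coding no node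
    impose nothing. *)
Definition accepting_at (n : nat) t rho :=
  if pickle_inv n is Some u then
    [/\ rho [::] = init A,
        (rho u, t u, rho (rcons u l), rho (rcons u r)) \in delta A &
        exists k, hits rho u k]
  else True.

Lemma accepting_runsE t rho :
  accepting_runs A t rho <-> forall n, accepting_at n t rho.
Proof.
split=> [[[rho0 run] /acceptingP hit] n|acc].
  by rewrite /accepting_at; case: pickle_inv.
have {}acc u : [/\ rho [::] = init A,
    (rho u, t u, rho (rcons u l), rho (rcons u r)) \in delta A &
    exists k, hits rho u k].
  by have := acc (pickle u); rewrite /accepting_at pickleK_inv.
split; first by split=> [|u]; [have [] := acc [::]|have [] := acc u].
by apply/acceptingP => u; have [] := acc u.
Qed.

Lemma accepting_at_open n t rho : accepting_at n t rho ->
  exists m, forall t' rho', stem m t' = stem m t -> stem m rho' = stem m rho ->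
    accepting_at n t' rho'.
Proof.
rewrite /accepting_at; case: pickle_inv => [u|]; last by exists 0.
(* Only nodes of length at most [d] are read, the successor making room for the sons of [u]; the
   largest code of these finitely many nodes determines the stem length. *)
move=> [rho0 run [k hit]]; pose d := (size u + k).+1.
exists (\max_(v : d.-bseq direction) pickle (v : node)).+1.
move=> t' rho' /stemP tt' /stemP rr'.
have short (v : node) : size v <= d ->
    pickle v < (\max_(v : d.-bseq direction) pickle (v : node)).+1.
  move=> vd; rewrite ltnS.
  exact: (@leq_bigmax _ (fun v : d.-bseq direction => pickle (v : node)) (Bseq vd)).
have dE (v : node) : size v <= d -> rho' v = rho v by move=> /short/rr'.
have ud : size u <= d by rewrite leqW// leq_addr.
have ucd c : size (rcons u c) <= d by rewrite size_rcons ltnS leq_addr.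
rewrite !dE//= tt' ?short//; split=> //; exists k => w wk.
have [j [j0 jk Fj]] := hit w wk; exists j; split=> //.
by rewrite dE// size_cat size_takel ?wk// leqW// leq_add2l.
Qed.

End Acceptance.

(** * Application to the runs of the automaton *)

Lemma borel_coordinate (X : finType) u s : borel [set x : tree X | x u = s].
Proof.
apply: sub_sigma_algebra.
have -> : [set x : tree X | x u = s] = proj u @^-1` [set s] by [].
apply: open_comp => [x _|]; first exact: proj_continuous.
exact: discrete_open.
Qed.

Theorem theorem4p12 (Sigma : finType) (A : buchi_automaton Sigma) :
  analytic (language A) -> ~ borel (language A) ->
  has_card_continuum
    [set t : tree Sigma | has_card_continuum (accepting_runs A t)].
Proof.
move=> _ nborel.
have [|f [g [finj ginj fg]]] := nonborel_proj_many_large_fibres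
  (smallest_sigma_algebra setT (@open (tree Sigma))) (@borel_coordinate Sigma)
  (@accepting_at_open Sigma A).
  apply: contra_not nborel; congr (borel _).
  apply/seteqP; split=> t [rho Hrho]; exists rho; exact/accepting_runsE.
apply: (has_card_continuum_inj finj) => a /=.
apply: (has_card_continuum_inj (ginj a)) => b.
by apply/accepting_runsE; exact: fg.
Qed.
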